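(* For any integers $g \geq h \geq 2$ and any integer $n \geq 1$, there exists a set $A \subset [n]$ that is a weak $C_h[g]$-set in $\mathbb{Z}$ and satisfies $$|A| \geq \frac{1}{8}\, n^{\left(1 - \frac{1}{h}\right)\left(1 - \frac{1}{g}\right)\left(1 + \frac{1}{hg-1}\right)}.$$
   Context: $[n] = \{1,2,\dots,n\}$. Let $\Gamma$ be an abelian group and $g \geq h \geq 2$ integers. A set $A \subset \Gamma$ is a weak $C_h[g]$-set if, for any set $X \subset \Gamma$ with $|X| = h$ and any set $\{k_1,\dots,k_g\} \subset \Gamma$ of $g$ distinct elements such that the translates $X + k_1, \dots, X + k_g$ are pairwise disjoint, at least one of the translates $X + k_i := \{x + k_i : x \in X\}$ is not contained in $A$. Here $\Gamma = \mathbb{Z}$. *)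

(* Defs.v *)
From mathcomp Require Import all_boot all_order all_algebra finmap.
From mathcomp Require Import boolp classical_sets reals exp.

Set Implicit Arguments.
Unset Strict Implicit.
Unset Printing Implicit Defensive.

Import Order.TTheory GRing.Theory Num.Theory.

Local Open Scope ring_scope.
Local Open Scope classical_set_scope.

Definition translate (G : zmodType) (X : set G) (k : G) : set G :=
  [set x + k | x in X].

(* The finite set [K] is the set {k_1, ..., k_g} of shifts; as a set of
   cardinality [g] it carries the requirement that they be distinct. *)
Definition weak_C_set (G : zmodType) (h g : nat) (A : set G) : Prop :=
  forall X K : {fset G},
    #|` X|%fset = h -> #|` K|%fset = g ->
    (forall k l : G, k \in K -> l \in K -> k != l ->
       translate [set` X] k `&` translate [set` X] l = set0) ->
    exists2 k : G, k \in K & ~ (translate [set` X] k `<=` A).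

(* Main.v *)
(* If A in [n] fails to be weak C_h[g], it contains a grid X + K of exactly hg
   elements. There are at most n^(h+g-1) such grids in [n], so keeping each
   element of [n] with probability 1/k and deleting one element per surviving
   grid leaves about n/k - n^(h+g-1) / k^(hg) elements; taking k between 2D and
   3D with D = n^((h+g-2)/(hg-1)) makes the loss at most 1/8 of the gain, and
   n/D is the required power of n. *)
Require Import Defs.
From mathcomp Require Import all_boot all_order all_algebra finmap.
From mathcomp Require Import boolp classical_sets reals exp.
From mathcomp Require Import zify ring lra.

Set Implicit Arguments.
Unset Strict Implicit.
Unset Printing Implicit Defensive.

Import Order.TTheory GRing.Theory Num.Theory.

(** The values off [S] are free. With [W] as colours and [c] marking the kept vertices, this counts
    the colourings that keep all of [S]. *)
Lemma card_ffun_const_on (V W : finType) (S : {set V}) (c : W) :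
  #|[set f : {ffun V -> W} | S \subset f @^-1: [set c]]%SET|
    = (#|W| ^ (#|V| - #|S|))%N.
Proof.
pose F x : {pred W} := if x \in S then pred1 c else predT.
have -> : #|[set f : {ffun V -> W} | S \subset f @^-1: [set c]]%SET|
    = #|family F|.
  apply: eq_card => f; rewrite inE; apply/fintype.subsetP/familyP => Sf x.
    rewrite /F; case: ifP => // xS.
    by have := Sf x xS; rewrite !inE.
  by move=> xS; have := Sf x; rewrite /F xS !inE.
rewrite card_family foldrE big_map big_enum /=.
rewrite (bigID [in S]) /= big1 ?mul1n; last first.
  by move=> x xS; rewrite /F xS card1.
rewrite (eq_bigr (fun=> #|W|)); last by move=> x /negPf xS; rewrite /F xS.
rewrite prod_nat_const -(cardsC S) addKn.
by congr (_ ^ _)%N; apply: eq_card => x; rewrite !inE.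
Qed.

(** Averaging: if [G i < F i] held everywhere, the sums would compare strictly, with the term at
    [i0] supplying the strictness. *)
Lemma sum_leq_exists (I : finType) (i0 : I) (F G : I -> nat) :
  (\sum_i F i <= \sum_i G i)%N -> exists i, (F i <= G i)%N.
Proof.
move=> leFG; apply/existsP; apply: contraLR leFG.
rewrite negb_exists -ltnNge => /forallP gtFG.
rewrite (bigD1 i0) //= [in leqRHS](bigD1 i0) //= -addSn leq_add //.
  by rewrite ltnNge gtFG.
by apply: leq_sum => i _; rewrite leqNgt -leqNgt ltnW // ltnNge gtFG.
Qed.

(** Double counting, which plays the role of linearity of expectation. *)
Lemma sum_card_swap (I J : finType) (P : pred J) (E : I -> J -> bool) :
  (\sum_i #|[set j | P j && E i j]%SET|
   = \sum_(j | P j) #|[set i | E i j]%SET|)%N.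
Proof.
under eq_bigr do rewrite -sum1dep_card big_mkcondr.
by rewrite exchange_big /=; apply: eq_bigr => j _; rewrite -big_mkcond sum1dep_card.
Qed.

(* Keep every vertex independently with probability 1/k, then delete one vertex
   of every surviving edge. *)
Lemma sparse_hypergraph_independent_set (V T : finType) (e : T -> {set V})
    (P : pred T) (r k : nat) :
  (0 < r)%N -> (0 < k)%N -> (forall t, P t -> #|e t| = r) ->
  exists A : {set V}, (forall t, P t -> ~~ (e t \subset A)) /\
    (#|V| * k ^ r.-1 <= k ^ r * #|A| + #|T|)%N.
Proof.
case: r => // r _; case: k => // k _ card_e /=; set q := k.+1.
(* A uniform colouring with [q] colours gives each vertex the colour [ord0] with probability 1/q,
   independently. *)
pose kept (f : {ffun V -> 'I_q}) : {set V} := (f @^-1: [set ord0])%SET.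
pose full f := [set t | P t && (e t \subset kept f)]%SET.
have sum_kept : ((\sum_f #|kept f|) * q = #|V| * q ^ #|V|)%N.
  have -> : (\sum_f #|kept f| = \sum_(x : V) q ^ #|V|.-1)%N.
    transitivity (\sum_f #|[set x | predT x && ([set x]%SET \subset kept f)]%SET|)%N.
      by apply: eq_bigr => f _; apply: eq_card => x; rewrite [RHS]inE /= finset.sub1set.
    rewrite sum_card_swap; apply: eq_bigr => x _.
    by rewrite card_ffun_const_on card_ord cards1 subn1.
  rewrite sum_nat_const -mulnA -expnSr.
  by case: (#|V|) => // N; rewrite mul0n.
have sum_full : ((\sum_f #|full f|) * q ^ r.+1 <= #|T| * q ^ #|V|)%N.
  rewrite sum_card_swap big_distrl /=.
  rewrite (eq_bigr (fun=> q ^ #|V|)%N) => [|t Pt]; last first.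
    rewrite card_ffun_const_on card_ord card_e // -expnD subnK //.
    by rewrite -(card_e t Pt) max_card.
  by rewrite sum_nat_const leq_mul2r max_card orbT.
(* Some [f] has kept minus full at least |V|/q - |T|/q^(r+1), here multiplied by q^(r+1) and written
   without subtraction. *)
have [|f le_f] := @sum_leq_exists _ [ffun=> ord0]
  (fun f => #|V| * q ^ r + #|full f| * q ^ r.+1)%N
  (fun f => #|kept f| * q ^ r.+1 + #|T|)%N.
  rewrite !big_split /= !sum_nat_const -!big_distrl /= card_ffun card_ord.
  have -> : ((\sum_f #|kept f|) * q ^ r.+1 = #|V| * q ^ #|V| * q ^ r)%N.
    by rewrite expnS mulnA sum_kept.
  rewrite leq_add //; last by rewrite [leqRHS]mulnC.
  by rewrite mulnCA mulnA leqnn.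
have e_neq0 t : P t -> exists x, x \in e t.
  by move=> Pt; apply/card_gt0P; rewrite card_e.
(* The default of [pt] needs a vertex; without vertices there are no edges, as edges are
   nonempty. *)
have [x0 _ | V0] := pickP V; last first.
  exists finset.set0; split=> [t Pt|].
    by have [x _] := e_neq0 t Pt; have := V0 x.
  by rewrite eq_card0.
pose pt t := odflt x0 [pick x in e t].
have pt_in t : P t -> pt t \in e t.
  by move=> /e_neq0[x xt]; rewrite /pt; case: pickP => // /(_ x); rewrite xt.
(* An edge inside this set would be full, so its own chosen point would have been deleted. *)
exists (kept f :\: pt @: full f)%SET; split=> [t Pt|].
  apply/negP => et_sub; have := fintype.subsetP et_sub _ (pt_in t Pt).
  rewrite inE => /andP[/negP[]]; apply: imset_f; rewrite inE Pt /=.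
  by apply: fintype.subset_trans et_sub _; exact: finset.subsetDl.
have card_del : (#|kept f| <= #|kept f :\: pt @: full f| + #|full f|)%N.
  rewrite -(cardsID (pt @: full f) (kept f)) addnC leq_add2l.
  apply: leq_trans (leq_imset_card pt (full f)).
  exact: subset_leq_card (finset.subsetIr _ _).
rewrite -(leq_add2r (#|full f| * q ^ r.+1)); apply: leq_trans le_f _.
rewrite addnAC leq_add2r mulnC [(#|full f| * _)%N]mulnC -mulnDr.
by rewrite leq_mul2l card_del orbT.
Qed.

Local Open Scope ring_scope.
Local Open Scope classical_set_scope.

(* For a grid [X + K] with base point [a = x0 + k0], the sets [a :: u = X + k0]
   and [a :: v = x0 + K] determine it as [(a :: u) + (a :: v) - a]. *)
Definition grid_sums n p q (t : 'I_n * p.-tuple 'I_n * q.-tuple 'I_n) :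
    {set 'I_n} :=
  let: (a, u, v) := t in
  [set z : 'I_n | (z + a)%N \in [seq (x + y)%N | x <- map val (a :: u),
                                                  y <- map val (a :: v)]].

(** A violating pair [X], [K] has all of X + K in the set, and disjoint translates make its sums
    distinct, so it is a full-size grid inside [B]. The successor shifts ['I_n] onto [n]. *)
Lemma grid_free_weak_C_set (n p q : nat) (B : {set 'I_n}) :
  (forall t : 'I_n * p.-tuple 'I_n * q.-tuple 'I_n,
     #|grid_sums t| == (p.+1 * q.+1)%N -> ~~ (grid_sums t \subset B)) ->
  weak_C_set p.+1 q.+1 [set` [fset (i.+1)%:Z | i : 'I_n in B]%fset].
Proof.
move=> freeB X K cX cK disj; apply: contrapT => noK.
have inA x k : x \in X -> k \in K -> exists2 i : 'I_n, i \in B & x + k = (i.+1)%:Z.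
  move=> xX kK; have subA : translate [set` X] k `<=` [set` [fset (i.+1)%:Z | i : 'I_n in B]%fset].
    by apply: contrapT => nsub; apply: noK; exists k.
  have /imfsetP[i /= iB ->] : x + k \in [fset (i.+1)%:Z | i : 'I_n in B]%fset.
    by apply: subA; exists x.
  by exists i.
have := erefl (enum_fset X); case: {2}(enum_fset X) => [|x0 xs] EX.
  by move: cX; rewrite EX.
have := erefl (enum_fset K); case: {2}(enum_fset K) => [|k0 ks] EK.
  by move: cK; rewrite EK.
have inX x : (x \in X) = (x \in x0 :: xs) by rewrite -EX.
have inK x : (x \in K) = (x \in k0 :: ks) by rewrite -EK.
have x0X : x0 \in X by rewrite inX mem_head.
have k0K : k0 \in K by rewrite inK mem_head.
have [i0 _ _] := inA x0 k0 x0X k0K.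
(* Inverse of the shift by one; the default [i0] is never reached on X + K. *)
pose phi (z : int) : 'I_n := insubd i0 `|z - 1|%N.
have phiE x k : x \in X -> k \in K -> phi (x + k) \in B /\ (phi (x + k)).+1%:Z = x + k.
  move=> xX kK; have [i iB ->] := inA x k xX kK.
  suff -> : phi (i.+1)%:Z = i by [].
  rewrite -[RHS](valKd i0); congr insubd; rewrite /=; lia.
have size_u : size [seq phi (x + k0) | x <- xs] == p.
  by rewrite size_map -eqSS -cX EX.
have size_v : size [seq phi (x0 + k) | k <- ks] == q.
  by rewrite size_map -eqSS -cK EK.
pose t := (phi (x0 + k0), Tuple size_u, Tuple size_v).
pose s := [seq phi (x + k) | x <- X, k <- K].
(* Each side is a sum of two shifted indices, so the ones cancel and the relation holds for the
   indices themselves. *)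
have phi_add x k : x \in X -> k \in K ->
    (phi (x + k)%R + phi (x0 + k0)%R = phi (x + k0)%R + phi (x0 + k)%R)%N.
  move=> xX kK; have [_ e1] := phiE _ _ xX kK; have [_ e2] := phiE _ _ x0X k0K.
  have [_ e3] := phiE _ _ xX k0K; have [_ e4] := phiE _ _ x0X kK.
  have succ_add (a b c d : nat) :
    (a.+1)%:Z + (b.+1)%:Z = (c.+1)%:Z + (d.+1)%:Z -> (a + b = c + d)%N by lia.
  by apply: succ_add; rewrite e1 e2 e3 e4 addrACA [k + _]addrC addrACA.
have gridE : grid_sums t =i s.
  have uE : map val (phi (x0 + k0) :: [seq phi (x + k0) | x <- xs])
      = [seq val (phi (x + k0)) | x <- x0 :: xs] by rewrite /= -map_comp.
  have vE : map val (phi (x0 + k0) :: [seq phi (x0 + k) | k <- ks])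
      = [seq val (phi (x0 + k)) | k <- k0 :: ks] by rewrite /= -map_comp.
  move=> z; rewrite inE uE vE allpairs_mapl allpairs_mapr.
  rewrite /s EX EK; apply/allpairsP/allpairsP => -[[x k] /= []]; rewrite -inX -inK.
    move=> xX kK zE; exists (x, k); split; rewrite -?inX -?inK //=.
    by apply/val_inj/eqP; rewrite -(eqn_add2r (phi (x0 + k0))) zE phi_add.
  move=> xX kK ->; exists (x, k); split; rewrite -?inX -?inK //=.
  exact: phi_add.
(* Equal sums with different shifts would give a common point of two disjoint translates. *)
have uniq_s : uniq s.
  apply: allpairs_uniq; rewrite ?fset_uniq // => -[x k] [y l].
  move=> /allpairsP[[x' k'] /= [xX kK [-> ->]]].
  move=> /allpairsP[[y' l'] /= [yX lK [-> ->]]] eq_phi.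
  have eq_sum : x' + k' = y' + l'.
    by have [_ <-] := phiE _ _ xX kK; have [_ <-] := phiE _ _ yX lK; rewrite eq_phi.
  have [kl|kl] := eqVneq k' l'; first by move: eq_sum; rewrite kl => /addIr ->.
  have := disj k' l' kK lK kl; move=> /seteqP[+ _] => /(_ (x' + k'))[].
  by split; [exists x' | exists y'].
have card_t : #|grid_sums t| == (p.+1 * q.+1)%N.
  by rewrite (eq_card gridE) (card_uniqP uniq_s) size_allpairs -cX -cK.
have /negP[] := freeB t card_t.
apply/fintype.subsetP => z; rewrite gridE => /allpairsP[[x k] /= [xX kK ->]].
by have [] := phiE x k xX kK.
Qed.

Lemma natr_between_double_triple (R : realType) (D : R) :
  1 <= D -> exists2 k : nat, (0 < k)%N & 2 * D <= k%:R <= 3 * D.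
Proof.
move=> D1; exists (Num.truncn (2 * D)).+1 => //.
have /andP[] := @truncn_itv R (2 * D) ltac:(lra).
rewrite -natr1; lra.
Qed.

Theorem theorem4 (R : realType) (g h n : nat)
    (h_ge2 : (2 <= h)%N) (g_geh : (h <= g)%N) (n_ge1 : (1 <= n)%N) :
  exists A : {fset int},
    [/\ forall a : int, a \in A -> 1 <= a <= n%:Z,
        weak_C_set h g [set` A]
      & 1 / 8 * n%:R `^ ((1 - 1 / h%:R) * (1 - 1 / g%:R)
                         * (1 + 1 / (h%:R * g%:R - 1)))
          <= #|` A|%fset%:R :> R].
Proof.
case: h h_ge2 g_geh => [|[|p]] // _; case: g => [|[|q]] // _.
set h := p.+2; set g := q.+2; set r := (h * g)%N.
pose d : R := (p + q).+2%:R / r.-1%:R.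
pose D : R := n%:R `^ d.
have n1 : (1 : R) <= n%:R by rewrite ler1n.
have r1_gt0 : (0 : R) < r.-1%:R by rewrite ltr0n /r; lia.
have D1 : 1 <= D.
  by rewrite -(powRr0 n%:R) ler_powR // divr_ge0.
have [k k0 /andP[leDk lekD]] := natr_between_double_triple D1.
(* The tuples have lengths h-1 and g-1, so the index type has n^(h+g-1) elements; degenerate grids
   are filtered out by the predicate. *)
have [B [freeB]] := @sparse_hypergraph_independent_set _ _
  (@grid_sums n p.+1 q.+1) (fun t => #|grid_sums t| == r) r k
  ltac:(by []) k0 (fun t => @eqP _ _ _).
rewrite !card_prod !card_tuple !card_ord => card_B.
exists [fset (i.+1)%:Z | i : 'I_n in B]%fset; split.
- by move=> _ /imfsetP[i _ ->]; have := ltn_ord i; lia.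
- exact: grid_free_weak_C_set freeB.
rewrite card_imfset /=; last by move=> i j [/val_inj].
rewrite -cardE.
have D_pow : D ^+ r.-1 = n%:R ^+ (p + q).+2.
  rewrite -[LHS]powR_mulrn ?powR_ge0 // -powRrM divfK ?gt_eqF //.
  by rewrite powR_mulrn // ler0n.
(* Both exponents equal (h-1)(g-1)/(hg-1) = 1 - (h+g-2)/(hg-1). *)
have -> : n%:R `^ ((1 - 1 / h%:R) * (1 - 1 / g%:R) * (1 + 1 / (h%:R * g%:R - 1)))
    = n%:R / D.
  rewrite -[n%:R in RHS]powRr1 ?ler0n // -powRB; last first.
    by apply/implyP => _; rewrite pnatr_eq0 -lt0n.
  congr (_ `^ _); rewrite /d.
  have rE : r.-1%:R = h%:R * g%:R - 1 :> R.
    by rewrite -natrM -[(h * g)%N]/(r.-1.+1) -natr1 addrK.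
  have -> : (p + q).+2%:R = h%:R + g%:R - 2 :> R.
    by rewrite /h /g -!natr1 natrD; lra.
  have h0 : h%:R != 0 :> R by rewrite pnatr_eq0.
  have g0 : g%:R != 0 :> R by rewrite pnatr_eq0.
  move: r1_gt0; rewrite rE => /lt0r_neq0 hg0.
  by field; rewrite h0 g0 hg0.
have card_BR : n%:R * k%:R ^+ r.-1 <= k%:R ^+ r * #|B|%:R + n%:R * D ^+ r.-1 :> R.
  rewrite D_pow -!natrX -!natrM -natrD ler_nat; apply: leq_trans card_B _.
  by rewrite leq_add2l -mulnA -expnD addSn addnS.
(* Since hg is at least 4, (2D)^(hg-1) carries a factor of at least 2^3. *)
have D_le : 8 * D ^+ r.-1 <= k%:R ^+ r.-1.
  have -> : r.-1 = (3 + (r - 4))%N by rewrite /r /h /g; nia.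
  apply: (@le_trans _ _ ((2 * D) ^+ (3 + (r - 4)))).
    rewrite exprMn ler_wpM2r ?exprn_ge0 ?powR_ge0 // exprD.
    have : 1 <= 2 ^+ (r - 4) :> R by rewrite exprn_ege1 // ler1n.
    lra.
  by rewrite lerXn2r // nnegrE; lra.
have kpow_gt0 : 0 < k%:R ^+ r.-1 :> R by rewrite exprn_gt0 // ltr0n.
have le_nk : 7 / 8 * n%:R <= k%:R * #|B|%:R :> R.
  rewrite -(ler_pM2l kpow_gt0) [leRHS]mulrA -exprSr.
  have -> : r.-1.+1 = r by rewrite prednK.
  have : n%:R * (8 * D ^+ r.-1) <= n%:R * k%:R ^+ r.-1 by rewrite ler_wpM2l.
  lra.
have B0 : 0 <= #|B|%:R :> R by [].
rewrite mulrA ler_pdivrMr; last lra.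
(* Hence |B| is at least (7/24) n/D, which exceeds (1/8) n/D. *)
have : k%:R * #|B|%:R <= 3 * D * #|B|%:R by rewrite ler_wpM2r.
nra.
Qed.
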